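(* Let $x_i$ ($i \ge 0$), $y_{i,j}$ ($0 \le i \le j$), $u$ and $v$ be commuting indeterminates. For a nonempty finite set $A$ of nonnegative integers put $\Theta_A = 1$ if $|A| = 1$, and if $|A| > 1$ put $$\Theta_A = x_{\min(A)}\, y_{\max(A),\max(A)} \prod_{i \in A \setminus \{\max(A),\min(A)\}} \left( y_{i,i}\sum_{\substack{j \in A \\ j \leq i}} x_j + x_i \sum_{\substack{j \in A \\ j > i}} y_{i,j} \right).$$ Then for any finite set $A$ of positive integers, $$\left. \Theta_{A \cup \{0\}} \right|_{x_0 = u + v} = \sum_{B \sqcup C = A} \left. \Theta_{B \cup \{0\}} \right|_{x_0 = u} \left. \Theta_{C \cup \{0\}} \right|_{x_0 = v},$$ where the sum is over all ordered pairs $(B,C)$ of (possibly empty) sets with $B \cup C = A$ and $B \cap C = \emptyset$.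
   Context: The notation $|_{x_0 = z}$ means substituting $z$ for the indeterminate $x_0$ in the polynomial. *)

(* Defs.v *)
From HB Require Import structures.
From mathcomp Require Import all_boot all_order all_algebra.
From mathcomp Require Import finmap.
From mathcomp.multinomials Require Import monalg.

Set Implicit Arguments.
Unset Strict Implicit.
Unset Printing Implicit Defensive.

Import GRing.Theory.
Local Open Scope fset_scope.
Local Open Scope ring_scope.

(* The indeterminates y_{i,j} with i > j are also present; they occur in none
   of the polynomials below. *)
Inductive indet : Type :=
  | IX of nat
  | IY of nat & nat
  | IU
  | IV.

Definition indet_code (k : indet) : nat + nat * nat + bool :=
  match k with
  | IX i => inl (inl i)
  | IY i j => inl (inr (i, j))
  | IU => inr false
  | IV => inr true
  end.

Definition indet_decode (c : nat + nat * nat + bool) : indet :=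
  match c with
  | inl (inl i) => IX i
  | inl (inr (i, j)) => IY i j
  | inr false => IU
  | inr true => IV
  end.

Lemma indet_codeK : cancel indet_code indet_decode.
Proof. by case. Qed.

HB.instance Definition _ := Equality.copy indet (can_type indet_codeK).
HB.instance Definition _ := Choice.copy indet (can_type indet_codeK).

(* The polynomial ring over K in these infinitely many indeterminates, as the
   monoid algebra of the free commutative monoid on indet. *)
Notation polyI K := {malg K[{cmonom indet}]}.

Definition indetP (K : comNzRingType) (k : indet) : polyI K := << ucm k >>.

Definition xvar (K : comNzRingType) (i : nat) : polyI K := indetP K (IX i).
Definition yvar (K : comNzRingType) (i j : nat) : polyI K := indetP K (IY i j).
Definition uvar (K : comNzRingType) : polyI K := indetP K IU.
Definition vvar (K : comNzRingType) : polyI K := indetP K IV.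

Definition monom_subst_x0 (K : comNzRingType) (z : polyI K)
    (m : {cmonom indet}) : polyI K :=
  \prod_(k <- finsupp m) (if k == IX 0 then z else indetP K k) ^+ m k.

Definition subst_x0 (K : comNzRingType) (z p : polyI K) : polyI K :=
  mmap (@malgC {cmonom indet} K) (monom_subst_x0 z) p.

Definition fsmax (A : {fset nat}) : nat := (\max_(i <- A) i)%N.
(* The initial value fsmax A is neutral as soon as A is nonempty. *)
Definition fsmin (A : {fset nat}) : nat := \big[minn/fsmax A]_(i <- A) i.

(* Meaningful for nonempty A only. *)
Definition Theta (K : comNzRingType) (A : {fset nat}) : polyI K :=
  if #|` A| == 1%N then 1 else
  xvar K (fsmin A) * yvar K (fsmax A) (fsmax A) *
  \prod_(i <- A `\` [fset fsmax A; fsmin A])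
    (yvar K i i * (\sum_(j <- A | (j <= i)%N) xvar K j)
     + xvar K i * (\sum_(j <- A | (i < j)%N) yvar K i j)).

(* Main.v *)
(** With [x_0] replaced by [z], [Theta (A + 0)] is the determinant of the
    Laplacian on [A] with edge weights [c i j = y_ii x_j] for [j <= i] and
    [c i j = x_i y_ij] for [j > i], and with weight [z y_ii] for an edge from [i]
    to an extra root: the part of [c] on and below the diagonal has rank one, so
    two column operations make the matrix triangular.  By the matrix-tree theorem
    this determinant counts weighted rooted forests, and it is of binomial type in
    the root weights because a root of weight [t i + s i] is of one of two kinds.
    The latter is proved through determinants: both sides are affine in each
    [t k], with slopes that are instances of the same identity for [A] without
    [k], and they agree at [t = 0], where the Laplacian of a nonempty set is
    singular. *)
From HB Require Import structures.
Require Import Defs.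
From mathcomp Require Import all_boot all_order all_algebra.
From mathcomp Require Import finmap.
From mathcomp.multinomials Require Import monalg.
From mathcomp Require Import ring.
Import GRing.Theory.

Local Open Scope fset_scope.
Local Open Scope ring_scope.

Lemma big_fset_ord (S : Type) (idx : S) (op : Monoid.com_law idx) (n : nat)
    (A : {fset nat}) (F : nat -> S) : {in A, forall a, a < n}%N ->
  \big[op/idx]_(l <- A) F l = \big[op/idx]_(i < n | (i : nat) \in A) F i.
Proof.
move=> An; rewrite -(big_mkord (fun i => i \in A) F) /index_iota subn0.
rewrite -[RHS]big_filter; apply: perm_big; apply: uniq_perm.
- exact: fset_uniq.
- by rewrite filter_uniq ?iota_uniq.
by move=> a; rewrite mem_filter mem_iota /= add0n; case: (boolP (a \in A)) => // /An.
Qed.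

(* Rows outside [A] are those of the identity, so that the determinant is that
   of the block on [A] and all subsets of [A] share one matrix size. *)
Definition laplacian (R : comNzRingType) (n : nat) (c : nat -> nat -> R)
    (A : {fset nat}) (t : nat -> R) : 'M[R]_n :=
  \matrix_(i, j) if (i : nat) \in A
    then (t i + \sum_(l <- A) c i l) *+ (i == j) - c i j
    else (i == j)%:R.

(** * Laplacian determinants and their binomial type in the root weights *)

Section Forest.
Context {R : comNzRingType} (n : nat) (c : nat -> nat -> R).
Implicit Types (A B : {fset nat}) (s t : nat -> R).

Definition forest A t : R := \det (laplacian R n c A t).

Lemma eq_forest A t t' : {in A, t =1 t'} -> forest A t = forest A t'.
Proof.
move=> tt'; congr (\det _); apply/matrixP=> i j; rewrite !mxE.
by case: ifP => // /tt' ->.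
Qed.

Lemma forest_fset0 t : forest fset0 t = 1.
Proof.
rewrite /forest -(det1 R n); congr (\det _).
by apply/matrixP=> i j; rewrite !mxE inE.
Qed.

(** The row sums over [A]: the diagonal entry cancels all the weights [c i l], loops included, up to
    [t i]. *)
Lemma laplacian_mul_indic A t : {in A, forall a, a < n}%N ->
  laplacian R n c A t *m (\col_i ((i : nat) \in A)%:R)
  = \col_i (t i *+ ((i : nat) \in A)).
Proof.
move=> An; apply/matrixP=> i j; rewrite !mxE.
under eq_bigr => l _ do rewrite !mxE mulr_natr mulrb.
rewrite -big_mkcond /=.
case: (boolP ((i : nat) \in A)) => iA; last first.
  rewrite big1 // => l lA; case: eqP => // eq_il.
  by rewrite eq_il lA in iA.
rewrite big_split /= sumrN -(big_fset_ord _ _ _ n A (c i)) //.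
rewrite (bigD1 i) //= eqxx mulr1n [X in _ + X - _]big1 ?addr0 ?addrK //.
by move=> l /andP[_ /negPf]; rewrite eq_sym => ->.
Qed.

(** The indicator of [A] is a nonzero kernel vector. As [R] may have zero divisors, the adjugate
    turns this into determinant times indicator equal to 0, read at some [k] in [A]. *)
Lemma forest_eq0 A : A != fset0 -> {in A, forall a, a < n}%N ->
  forest A (fun=> 0) = 0.
Proof.
case/fset0Pn=> k kA An; have kn := An k kA.
have := congr1 (mulmx (\adj (laplacian R n c A (fun=> 0))))
  (laplacian_mul_indic A (fun=> 0) An).
rewrite mulmxA mul_adj_mx mul_scalar_mx => /matrixP/(_ (Ordinal kn) 0).
rewrite !mxE /= kA mulr1 /forest => ->.
by rewrite big1 // => i _; rewrite !mxE mul0rn mulr0.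
Qed.

(** Linearity in row [k], to which [a] times a unit vector is added. With that unit vector as row
    [k], the vertex [k] leaves [A], and the edges into it become edges to the root: hence the extra
    weight [c i k]. *)
Lemma forest_perturb A t a k : k \in A -> (k < n)%N ->
  forest A (fun i => t i + a *+ (i == k))
  = forest A t + a * forest (A `\ k) (fun i => t i + c i k).
Proof.
move=> kA kn; rewrite -[forest A t]mul1r.
have sumA i : \sum_(l <- A) c i l = c i k + \sum_(l <- A `\ k) c i l.
  by rewrite (big_fsetD1 k).
apply: (@determinant_multilinear _ _ _ _ _ (Ordinal kn)).
- apply/rowP=> j; rewrite !mxE /= kA !inE eqxx /= mulr1n mul1r.
  by case: eqP => _; rewrite /= ?mulr1n ?mulr0n; ring.
- apply/matrixP=> i j; rewrite !mxE /=; case: ifP => // _.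
  have /negPf-> : lift (Ordinal kn) i != k :> nat.
    by have := neq_lift (Ordinal kn) i; rewrite -val_eqE /= eq_sym.
  by rewrite mulr0n addr0.
- apply/matrixP=> i j; rewrite !mxE /= !inE.
  have /negPf-> /= : lift (Ordinal kn) i != k :> nat.
    by have := neq_lift (Ordinal kn) i; rewrite -val_eqE /= eq_sym.
  by rewrite mulr0n addr0 sumA addrA.
Qed.

Lemma big_fpowersetD1 A k (F : {fset nat} -> R) : k \in A ->
  \sum_(B <- fpowerset A | k \in B) F B = \sum_(B <- fpowerset (A `\ k)) F (k |` B).
Proof.
move=> kA; transitivity (\sum_(B <- [fset k |` C | C in fpowerset (A `\ k)]) F B); last first.
  rewrite big_imfset //= => B C.
  rewrite !fpowersetE !fsubsetD1 => /andP[_ kB] /andP[_ kC] e.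
  by rewrite -(fsetU1K kB) e fsetU1K.
rewrite big_fset_condE; apply: eq_fbigl => B; apply/idP/imfsetP => /= [|[C]].
  rewrite !inE /= fpowersetE => /andP[BA kB]; exists (B `\ k); last by rewrite fsetD1K.
  by rewrite fpowersetE fsetSD.
rewrite fpowersetE fsubsetD1 => /andP[CA _] ->.
by rewrite !inE /= fpowersetE eqxx fsubUset fsub1set kA CA.
Qed.

Lemma forestD A s t : {in A, forall a, a < n}%N ->
  forest A (fun i => t i + s i)
  = \sum_(B <- fpowerset A) forest B t * forest (A `\` B) s.
Proof.
have [m] := ubnP #|` A|; elim: m => // m IHm in A s t *.
rewrite ltnS => cardA An.
(* Inside the induction on the size of [A], a second induction runs on a list [r] outside which [t]
   vanishes on [A]; it restores one value [t k] at a time. *)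
pose supp (r : seq nat) t := {in A, forall i, i \notin r -> t i = 0}.
suff: forall r t, supp r t -> forest A (fun i => t i + s i)
  = \sum_(B <- fpowerset A) forest B t * forest (A `\` B) s.
  by move/(_ A t); apply=> i ->.
elim=> [|k r IHr] {}t t0.
  (* At [t = 0] only the term of the empty [B] survives, by [forest_eq0]. *)
  rewrite (big_fsetD1 fset0) ?fpowersetE ?fsub0set //= forest_fset0 mul1r fsetD0.
  rewrite big_seq big1 ?addr0 => [|B].
    by apply: eq_forest => i iA; rewrite t0 ?add0r.
  rewrite !inE fpowersetE => /andP[B0 /fsubsetP BA].
  rewrite (@eq_forest B t (fun=> 0)) ?forest_eq0 ?mul0r // => i /BA iA; first exact: An.
  by rewrite t0.
have [kA|kA] := boolP (k \in A); last first.
  apply: IHr => i iA ir; rewrite t0 // inE negb_or ir andbT.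
  by apply: contraNneq kA => <-.
pose t' i := if i == k then 0 else t i.
have tE i : t i = t' i + t k *+ (i == k).
  by rewrite /t'; case: eqP => [->|_]; rewrite ?add0r ?addr0.
have kn := An k kA.
transitivity (forest A (fun i => (t' i + s i) + t k *+ (i == k))).
  by apply: eq_forest => i _; rewrite tE addrAC.
rewrite forest_perturb // IHr => [|i iA ir]; last first.
  by rewrite /t'; case: eqP => // /eqP ik; rewrite t0 // inE negb_or ik.
(* In each term only the factor of [B] involves [t k], and only if [k] is in [B]; [forest_perturb]
   gives its slope. *)
transitivity (\sum_(B <- fpowerset A) (forest B t' * forest (A `\` B) s
  + (if k \in B then t k * (forest (B `\ k) (fun i => t' i + c i k) * forest (A `\` B) s) else 0))).
  rewrite big_split /= -big_mkcond /= -mulr_sumr; congr (_ + _ * _).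
  rewrite big_fpowersetD1 //.
  (* Grouping [c i k] with [t'] matches the slopes of the factors of [B], so that the outer
     induction hypothesis for [A] without [k] applies. *)
  transitivity (forest (A `\ k) (fun i => (t' i + c i k) + s i)).
    by apply: eq_forest => i _; rewrite addrAC.
  rewrite IHm.
  - apply: eq_big_seq => B; rewrite fpowersetE fsubsetD1 => /andP[_ kB].
    by rewrite fsetU1K // fsetDDl.
  - by rewrite (cardfsD1 k) kA in cardA.
  - by move=> i; rewrite !inE => /andP[_]; exact: An.
apply: eq_big_seq => B; rewrite fpowersetE => /fsubsetP BA.
rewrite (@eq_forest B t (fun i => t' i + t k *+ (i == k))) //.
case: ifP => kB; first by rewrite forest_perturb // mulrDl mulrA.
rewrite addr0; congr (_ * _); apply: eq_forest => i iB.
by case: eqP => [ik|_]; [rewrite -ik iB in kB | rewrite addr0].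
Qed.

End Forest.

(** * Product formula when the lower triangle of the weights has rank one *)

Section TriangularLowerPart.
Context {R : comNzRingType} (n : nat) (c : nat -> nat -> R) (x y : nat -> R).
Hypothesis cE : forall i j, (j <= i)%N -> c i j = y i * x j.

(* Adding the columns of [A] to column [M] gives [z *: y]; the column [y] then
   clears the rank-one lower triangle.  Both steps are the factorization
   [L U = T W] below, where dividing by [z] is avoided. *)
Lemma forest_prod (A : {fset nat}) (M : nat) (z : R) :
  M \in A -> {in A, forall a, a <= M}%N -> (M < n)%N ->
  forest n c A (fun i => z * y i)
  = z * y M * \prod_(i <- A `\ M) (z * y i + \sum_(l <- A) c i l).
Proof.
move=> MA AM Mn; pose m := Ordinal Mn.
have An : {in A, forall a, a < n}%N by move=> a /AM /leq_ltn_trans; apply.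
pose L := laplacian R n c A (fun i => z * y i).
pose I (i : 'I_n) : R := ((i : nat) \in A)%:R.
pose U : 'M[R]_n := \matrix_(i, j) if j == m then I i else (i == j)%:R.
(* [T] carries [y] on [A] in column [m], and [x j] times that column is added to each column
   [j < m]. [W] undoes these additions and scales column [m] by [z]. *)
pose T : 'M[R]_n := \matrix_(i, j)
  if j == m then I i * y i else L i j + (I i * y i * x j) *+ (j < m)%N.
pose W : 'M[R]_n := \matrix_(i, j)
  if j == m then z *+ (i == m) else (i == j)%:R - (x j *+ (j < m)%N) *+ (i == m).
have UE i j : U i j = if j == m then I i else (i == j)%:R by rewrite mxE.
have TE i j : T i j = if j == m then I i * y i
    else L i j + (I i * y i * x j) *+ (j < m)%N by rewrite mxE.
have WE i j : W i j = if j == m then z *+ (i == m)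
    else (i == j)%:R - (x j *+ (j < m)%N) *+ (i == m) by rewrite mxE.
have LU : L *m U = T *m W.
  apply/matrixP=> i j; rewrite [LHS]mxE [RHS]mxE; case: (eqVneq j m) => [->|jm].
    have /matrixP/(_ i 0) := laplacian_mul_indic n c A (fun i => z * y i) An.
    rewrite [LHS]mxE [RHS]mxE => eqL.
    transitivity (z * y i *+ ((i : nat) \in A)).
      by rewrite -eqL; apply: eq_bigr => l _; congr (_ * _); rewrite UE eqxx mxE.
    rewrite (bigD1 m) //= TE WE !eqxx big1 ?addr0 => [|l /negPf lm].
      by rewrite mulr1n /I; case: (_ \in A); rewrite /= ?mulr0n ?mulr1n; ring.
    by rewrite WE eqxx lm mulr0n mulr0.
  rewrite (bigD1 j) //= UE (negPf jm) eqxx mulr1 big1 ?addr0; last first.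
    by move=> l /negPf lj; rewrite UE (negPf jm) lj mulr0.
  rewrite (bigD1 m) //= (bigD1 j) //= big1 ?addr0; last first.
    by move=> l /andP[/negPf lm /negPf lj]; rewrite WE (negPf jm) lm lj mulr0n subr0 mulr0.
  rewrite !TE !WE (negPf jm) !eqxx (eq_sym m) (negPf jm) /= !mulr0n mulr1n subr0.
  by case: (j < M)%N; rewrite ?mulr1n ?mulr0n; ring.
have detU : \det U = 1.
  (* [U] is upper unitriangular because [M] is the largest element of [A]. *)
  rewrite -det_tr det_trig => [|]; last first.
    apply/is_trig_mxP => i j ij; rewrite !mxE.
    case: eqVneq ij => [-> /= mj|_ ij]; last by rewrite -val_eqE gtn_eqF.
    by rewrite /I; case: (boolP (_ \in A)) => // /AM; rewrite leqNgt mj.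
  by rewrite big1 // => i _; rewrite !mxE /I eqxx; case: eqP => // ->; rewrite MA.
have detW : \det W = z.
  rewrite det_trig; last first.
    apply/is_trig_mxP => i j ij; rewrite !mxE -(val_eqE i j) (ltn_eqF ij).
    case: eqVneq => [jm|_]; first by rewrite -val_eqE ltn_eqF // -jm.
    case: eqVneq => [im|_]; last by rewrite mulr0n subr0.
    by rewrite -im ltnNge (ltnW ij) /= mulr0n subrr.
  rewrite (bigD1 m) //= !mxE !eqxx mulr1n big1 ?mulr1 // => i /negPf im.
  by rewrite !mxE im eqxx mulr0n subr0.
have := congr1 (@determinant _ _) LU; rewrite !det_mulmx detU detW mulr1 /forest => ->.
(* In [T] the added [y i * x j] cancels [- c i j] below the diagonal. On the diagonal, away from
   [m], it cancels [- c i i] and leaves the factors of the product. *)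
rewrite -det_tr det_trig => [|]; last first.
  apply/is_trig_mxP => i j ij; rewrite !mxE /I.
  case: eqVneq ij => [-> /= mj|im ij].
    by case: (boolP (_ \in A)) => [/AM|_]; rewrite ?mul0r // leqNgt mj.
  rewrite -val_eqE gtn_eqF //; case: (boolP (_ \in A)) => jA; last first.
    by rewrite !mul0r mul0rn addr0.
  rewrite (leq_trans ij) ?AM // mulr0n mulr1n cE ?(ltnW ij) //= mul1r; ring.
rewrite (bigD1 m) //= !mxE eqxx /I /= MA mul1r.
have TEm i : i != m -> T^T i i = if (i : nat) \in A
    then z * y i + \sum_(l <- A) c i l else 1.
  move=> im; rewrite !mxE (negPf im) /I eqxx; case: (boolP (_ \in A)) => iA.
    by rewrite ltn_neqAle AM // andbT (val_eqE i m) im !mulr1n cE //= mul1r; ring.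
  by rewrite !mul0r mul0rn addr0.
rewrite (eq_bigr _ TEm) -big_mkcondr /=.
rewrite (big_fset_ord _ _ _ n); last by move=> a; rewrite !inE => /andP[_ /An].
under [X in _ = _ * X]eq_bigl => i do rewrite !inE (val_eqE i m).
ring.
Qed.

End TriangularLowerPart.

(** * Substitution for [x_0] as a ring morphism *)

Section Substitution.
Context {K : comNzRingType} (z : polyI K).

Lemma monom_subst_x0_mmorphism : mmorphism (monom_subst_x0 z).
Proof.
pose g k := if k == IX 0 then z else indetP K k.
(* Exponents vanish off the support, so two monomials can be compared over one common index set. *)
have subE (d : {fset indet}) (m : {cmonom indet}) : finsupp m `<=` d ->
    monom_subst_x0 z m = \prod_(k <- d) g k ^+ m k.
  move=> md; rewrite /monom_subst_x0 (big_fset_incl _ md) // => k _.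
  by rewrite -cmE_eq0 => /eqP ->.
split=> [m1 m2|]; last by rewrite /monom_subst_x0 mdom1 big_seq_fset0.
rewrite !(subE (finsupp m1 `|` finsupp m2)) ?mdomD ?fsubsetUl ?fsubsetUr //.
by rewrite -big_split; apply: eq_bigr => k _; rewrite cmM exprD.
Qed.

HB.instance Definition _ := isMultiplicative.Build _ _ (monom_subst_x0 z)
  monom_subst_x0_mmorphism.

HB.instance Definition _ := GRing.RMorphism.copy (subst_x0 z)
  (mmap (@malgC {cmonom indet} K) (monom_subst_x0 z)).

Lemma subst_x0_indet k :
  subst_x0 z (indetP K k) = if k == IX 0 then z else indetP K k.
Proof.
rewrite /subst_x0 mmapU [_ 1](rmorph1 (@malgC _ K)) mul1r /monom_subst_x0 mdomU big_seq_fset1.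
by rewrite cmUU expr1.
Qed.

Lemma subst_x0_xvar0 : subst_x0 z (xvar K 0) = z.
Proof. exact: subst_x0_indet. Qed.

Lemma subst_x0_xvar i : i != 0%N -> subst_x0 z (xvar K i) = xvar K i.
Proof. by move=> i0; rewrite subst_x0_indet ifN //; apply: contraNneq i0 => -[->]. Qed.

Lemma subst_x0_yvar i j : subst_x0 z (yvar K i j) = yvar K i j.
Proof. exact: subst_x0_indet. Qed.

End Substitution.

(** * [Theta] after substitution as a Laplacian determinant *)

Lemma leq_fsmax (A : {fset nat}) : {in A, forall a, a <= fsmax A}%N.
Proof. by move=> a aA; rewrite /fsmax (big_fsetD1 a) //= leq_maxl. Qed.

Lemma fsmax_in (A : {fset nat}) : A != fset0 -> fsmax A \in A.
Proof.
have max_mem (s : seq nat) : s != [::] -> (\max_(i <- s) i)%N \in s.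
  elim: s => // a [|b s] IHs _; first by rewrite big_seq1 mem_seq1.
  rewrite big_cons; case: (leqP a (\max_(i <- b :: s) i)%N) => _.
    by rewrite inE IHs ?orbT.
  by rewrite mem_head.
by move=> A0; apply: max_mem; rewrite -size_eq0 cardfs_eq0.
Qed.

(* Stated over an abstract ring: in [polyI K], unification would unfold the
   indeterminates to monomials. *)
Lemma rmorph_theta_prod {R S : comNzRingType} (f : {rmorphism R -> S})
    (x : nat -> R) (y : nat -> nat -> R) (x' : nat -> S) (y' : nat -> nat -> S)
    (z : S) (B : {fset nat}) (M : nat) :
  f (x 0%N) = z -> (forall i, i != 0%N -> f (x i) = x' i) ->
  (forall i j, f (y i j) = y' i j) -> 0%N \notin B ->
  f (x 0%N * y M M * \prod_(i <- B `\ M)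
       (y i i * (\sum_(j <- 0%N |` B | (j <= i)%N) x j)
        + x i * (\sum_(j <- 0%N |` B | (i < j)%N) y i j)))
  = z * y' M M * \prod_(i <- B `\ M) (z * y' i i
       + \sum_(j <- B) if (j <= i)%N then y' i i * x' j else x' i * y' i j).
Proof.
move=> fx0 fx fy B0; rewrite !rmorphM rmorph_prod /= fx0 fy.
have Bneq0 i : i \in B -> i != 0%N by apply: contraTneq => ->.
congr (_ * _ * _); apply: eq_big_seq => i; rewrite !inE => /andP[iM iB].
rewrite rmorphD !rmorphM !rmorph_sum /= fy fx ?Bneq0 // //.
(* The index 0 satisfies [j <= i] and never [i < j], so it contributes to the first sum only and
   yields the root weight [z * y' i i]. *)
rewrite [X in _ * X + _ = _]big_mkcond [X in _ + _ * X = _]big_mkcond !big_fsetU1 //= fx0.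
rewrite add0r mulrDr -addrA [z * _]mulrC.
congr (_ + _); rewrite !mulr_sumr -big_split /=; apply: eq_big_seq => j jB.
rewrite ltnNge fx ?fy; last exact: Bneq0.
by case: leqP => _; rewrite /= mulr0 ?addr0 ?add0r.
Qed.

Section ThetaForest.
Context {K : comNzRingType}.

Lemma fsmax_fsetU10 (B : {fset nat}) : fsmax (0%N |` B) = fsmax B.
Proof.
have [B0|B0] := boolP (0%N \in B); first by rewrite (fsetUidPr _ _ _) // fsub1set.
by rewrite /fsmax big_fsetU1 //= max0n.
Qed.

Lemma fsmin_fsetU10 (B : {fset nat}) : fsmin (0%N |` B) = 0%N.
Proof.
apply/eqP; rewrite -leqn0 /fsmin.
have: 0%N \in enum_fset (0%N |` B) by rewrite fset1U1.
elim: (enum_fset _) => // a s IHs; rewrite inE big_cons geq_min.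
by case/predU1P=> [<-|/IHs ->]; rewrite ?orbT.
Qed.

Definition edge_weight (i j : nat) : polyI K :=
  if (j <= i)%N then yvar K i i * xvar K j else xvar K i * yvar K i j.

(** The index 0 plays the root and [forest_prod] is applied with [M] the maximum of [B]. The size
    [n] is any strict bound, so that all subsets of one set can share it. *)
Lemma subst_x0_Theta (n : nat) (B : {fset nat}) (z : polyI K) :
  {in B, forall a, 0 < a < n}%N ->
  subst_x0 z (Theta K (0%N |` B))
  = forest n edge_weight B (fun i => z * yvar K i i).
Proof.
move=> Bn; have B0 : 0%N \notin B by apply/negP=> /Bn.
(* The convention that [Theta] of a singleton is 1 matches the determinant of the identity. *)
have [->|BN0] := eqVneq B fset0.
  by rewrite forest_fset0 /Theta fsetU0 cardfs1 /= rmorph1.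
have MB := fsmax_in _ BN0; have BM := leq_fsmax B; set M := fsmax B in MB BM.
have /andP[_ Mn] := Bn _ MB.
rewrite (@forest_prod _ n edge_weight (xvar K) (fun i => yvar K i i) _ B M z) //; last first.
  by move=> i j ji; rewrite /edge_weight ji.
rewrite /Theta cardfsU1 B0 fsmin_fsetU10 fsmax_fsetU10 -/M.
rewrite ifN; last by rewrite -[1%N]addn0 eqn_add2l cardfs_eq0.
have -> : (0%N |` B) `\` [fset M; 0%N] = B `\ M.
  apply/fsetP=> i; rewrite !inE; case: (eqVneq i 0%N) => [->|] //=.
    by rewrite orbT (negPf B0) andbF.
  by rewrite orbF.
exact: (rmorph_theta_prod (subst_x0 z) (xvar K) (yvar K) (xvar K) (yvar K) z B M
  (subst_x0_xvar0 z) (subst_x0_xvar z) (subst_x0_yvar z) B0).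
Qed.

End ThetaForest.

Theorem theorem1p3 (K : comNzRingType) (A : {fset nat})
    (Apos : forall a : nat, a \in A -> (0 < a)%N) :
  subst_x0 (uvar K + vvar K) (Theta K (0%N |` A)) =
  \sum_(B <- fpowerset A)
    \sum_(C <- fpowerset A | (B `|` C == A) && (B `&` C == fset0))
      subst_x0 (uvar K) (Theta K (0%N |` B)) * subst_x0 (vvar K) (Theta K (0%N |` C)).
Proof.
pose n := (fsmax A).+1.
have An : {in A, forall a, 0 < a < n}%N.
  by move=> a aA; rewrite Apos //= ltnS leq_fsmax.
rewrite (subst_x0_Theta n) //.
rewrite (@eq_forest _ _ _ _ _ (fun i => uvar K * yvar K i i + vvar K * yvar K i i)); last first.
  by move=> i _; rewrite mulrDl.
rewrite forestD => [|a /An/andP[]//].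
apply: eq_big_seq => B; rewrite fpowersetE => BA.
(* The complement of [B] in [A] is the only [C] satisfying both conditions. *)
transitivity (\sum_(C <- [fset A `\` B])
   subst_x0 (uvar K) (Theta K (0%N |` B)) * subst_x0 (vvar K) (Theta K (0%N |` C))).
  rewrite big_seq_fset1; congr (_ * _); apply/esym/subst_x0_Theta => a.
    by move/(fsubsetP BA); exact: An.
  by rewrite inE => /andP[_]; exact: An.
rewrite [RHS]big_fset_condE; apply: eq_fbigl => C; rewrite !inE /= fpowersetE.
apply/eqP/and3P => [->|[CA /eqP BC /eqP BC0]].
  split; first exact: fsubsetDl.
    by rewrite -{1}(fsetIidPr BA) fsetID.
  by rewrite fsetIDA (fsetIidPl BA) fsetDv.
apply/fsetP=> a; move/fsetP/(_ a): BC; move/fsetP/(_ a): BC0; rewrite !inE => BC0 <-.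
by move: BC0; do 2 case: (a \in _).
Qed.
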